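(* The maximum order $n$ of a non-Abelian group having a covering difference set $S$ of cardinality $s=7$ is $n=40$. The set $S=\{1,\,b,\,b^4,\,ba,\,ba^{-1}b^2,\,ab^{-1},\,bab^2\}$ in the group $\Gamma_1=\langle a,b\mid a^5=b^8=1,\ bab^{-1}=a^2\rangle$ (of order $40$) is a $(40,7,1,36)$ almost difference set.
   Context: Let $\Gamma$ be a finite group (written multiplicatively) and $S\subseteq\Gamma$. $S$ is a covering difference set (covering set) of $\Gamma$ if every element of $\Gamma$ is of the form $t\cdot t'^{-1}$ for some $t,t'\in S$. An $(n,s,\lambda,t)$-almost difference set (ADS) is a subset $S$ of size $s$ of a group of order $n$ such that the multiset of differences $\{t_i\cdot t_j^{-1}: t_i,t_j\in S\}$ contains exactly $t$ of the non-identity group elements exactly $\lambda$ times each, and all other non-identity group elements exactly $\lambda+1$ times each. *)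

(* Defs.v *)
From mathcomp Require Import all_boot all_fingroup.

Set Implicit Arguments.
Unset Strict Implicit.
Unset Printing Implicit Defensive.

Local Open Scope group_scope.

Definition covering_set (gT : finGroupType) (G : {group gT}) (S : {set gT}) :
    Prop :=
  S \subset G /\
  (forall g, g \in G -> exists t t', [/\ t \in S, t' \in S & g = t * t'^-1]).

(* Multiplicity of g in the multiset {t_i * t_j^-1 : t_i, t_j \in S}, indexed
   by ordered pairs; the pairs with t_i = t_j only contribute to g = 1. *)
Definition diff_mult (gT : finGroupType) (S : {set gT}) (g : gT) : nat :=
  #|[set p in setX S S | p.1 * p.2^-1 == g]|.

Definition almost_difference_set (gT : finGroupType) (G : {group gT})
    (S : {set gT}) (n s lambda t : nat) : Prop :=
  [/\ S \subset G, #|G| = n, #|S| = s,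
      #|[set g in G^# | diff_mult S g == lambda]| = t
    & forall g, g \in G^# -> diff_mult S g != lambda ->
        diff_mult S g = lambda.+1].

Definition is_maximum (P : nat -> Prop) (n : nat) : Prop :=
  P n /\ (forall m, P m -> m <= n).

Definition nonabelian_covering_order (s n : nat) : Prop :=
  exists (gT : finGroupType) (G : {group gT}) (S : {set gT}),
    [/\ ~~ abelian G, #|G| = n, #|S| = s & covering_set G S].

Definition Gamma1_relations (H : groupType) (a b : H) : Prop :=
  [/\ a ^+ 5 = 1, b ^+ 8 = 1 & b * a * b^-1 = a ^+ 2].

(* The universal property is required against all groups, finite or not:
   G \isog Grp (...) would only characterize the largest finite quotient of
   the presented group, and does not name the generators a and b, which are
   needed to write down S. *)
Definition is_Gamma1 (gT : finGroupType) (G : {group gT}) (a b : gT) : Prop :=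
  [/\ G :=: <<[set a; b]>>,
      Gamma1_relations a b
    & forall (H : groupType) (x y : H), Gamma1_relations x y ->
        exists f : gT -> H,
          [/\ {in G &, {morph f : u v / u * v}}, f a = x & f b = y]].

Definition Gamma1_S (gT : finGroupType) (a b : gT) : {set gT} :=
  [set 1; b; b ^+ 4; b * a; b * a^-1 * b ^+ 2; a * b^-1; b * a * b ^+ 2].

(* Main.v *)
(* A covering set of size 7 has at most 42 nontrivial differences, so n <= 43,
   and 41 and 43 are prime.  For n = 42, let e : G -> Z/2 be the sign of the
   regular representation, a surjective morphism.  If a elements of S lie in
   ker e and 7 - a outside, then 2 a (7 - a) of the 42 differences lie outside
   ker e; covering forces at least 21 there and at least 20 in ker e, hence
   a (7 - a) = 11, which has no solution.
   Gamma_1 is realised on Z/5 x Z/8 as a semidirect product, where the almost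
   difference set property is a finite check. *)
Require Import Defs.
From mathcomp Require Import all_boot all_fingroup.
From HB Require Import structures.
From mathcomp Require Import cyclic pgroup zify.

Set Implicit Arguments.
Unset Strict Implicit.
Unset Printing Implicit Defensive.

Local Open Scope group_scope.

(** * The sign of the regular representation *)

(** Every cycle is a pair [{x, s x}]. The number of cycles is what [odd_perm] reads off, so this
    computes the sign of a fixed-point-free involution. *)
Lemma card_porbits_involution (T : finType) (s : {perm T}) :
  (forall x, s x != x) -> (forall x, s (s x) = x) ->
  #|T| = (#|porbits s| * 2)%N.
Proof.
move=> s_neq sK.
have porbit2 x : porbit s x = [set x; s x].
  apply/setP=> y; rewrite !inE; apply/porbitP/idP => [[i ->] | /orP[] /eqP->].
  - elim: i => [|i IH]; first by rewrite expg0 perm1 eqxx.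
    by rewrite expgSr permM; case/orP: IH => /eqP->; rewrite ?sK eqxx ?orbT.
  - by exists 0; rewrite perm1.
  - by exists 1%N; rewrite expg1.
rewrite -cardsT; apply: card_uniform_partition => [A /imsetP[x _ ->]|].
  by rewrite porbit2 cards2 eq_sym s_neq.
(* The cycles are the orbits of the group generated by [s], hence they partition [T]. *)
have -> : porbits s = orbit 'P <[s]> @: [set: T].
  by apply/setP=> A; apply/imsetP/imsetP=> -[x _ ->];
    exists x; rewrite ?inE // porbit.unlock.
by apply: orbit_partition; apply/actsP=> u _ x; rewrite !inE.
Qed.

(* In the right regular representation an involution acts as a product of
   #|G|./2 transpositions, an odd permutation when #|G| = 2 mod 4. *)
Lemma regular_sign (gT : finGroupType) (G : {group gT}) m :
  #|G| = m.*2 -> odd m ->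
  exists e : gT -> bool,
    [/\ {in G &, {morph e : x y / x * y >-> x (+) y}}
      & #|[set x in G | e x]| = m].
Proof.
move=> cardG odd_m.
pose e x : bool := actperm 'R (subg G x).
have eM : {in G &, {morph e : x y / x * y >-> x (+) y}}.
  by move=> x y Gx Gy; rewrite /e -odd_permM -actpermM ?inE // -morphM.
exists e; split=> //.
have [z Gz oz] : {z | z \in G & #[z] = 2}.
  by apply: Cauchy => //; rewrite cardG -muln2 dvdn_mull.
have zz : z * z = 1 by rewrite -expg2 -oz expg_order.
have z1 : z != 1 by rewrite -order_eq1 oz.
have ez : e z.
  have cardT : #|{: [subg G]}| = m.*2 by rewrite card_sub -cardG.
  have fpfree (p : [subg G]) : actperm 'R (subg G z) p != p.
    rewrite actpermE /= -[eqbRHS]mulg1 (can_eq (mulKg _)).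
    by rewrite -(inj_eq val_inj) /= subgK.
  have invol (p : [subg G]) :
      actperm 'R (subg G z) (actperm 'R (subg G z) p) = p.
    by rewrite !actpermE /= -mulgA -morphM //= zz morph1 mulg1.
  have := card_porbits_involution fpfree invol.
  rewrite /e /odd_perm cardT odd_double -muln2 => /eqP.
  by rewrite eqn_pmul2r // => /eqP <-; rewrite odd_m.
(* Left multiplication by the odd involution [z] exchanges [A] and [B], so each is half of [G]. *)
pose A := [set x in G | e x]; pose B := [set x in G | ~~ e x].
have BA : #|B| = #|A|.
  have <- : mulg z @: A = B.
    apply/setP=> y; rewrite !inE; apply/imsetP/andP => [[x] | [Gy ey]].
      by rewrite inE => /andP[Gx ex] ->; rewrite groupM // eM // ez ex.
    exists (z * y); last by rewrite mulgA zz mul1g.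
    by rewrite inE groupM // eM // ez.
  by rewrite card_imset //; apply: mulgI.
have := cardsID [set x | e x] G; rewrite cardG.
have -> : G :&: [set x | e x] = A by apply/setP=> x; rewrite !inE.
have -> : G :\: [set x | e x] = B by apply/setP=> x; rewrite !inE andbC.
by rewrite BA addnn => /double_inj.
Qed.

(** * Counting differences: the upper bound 40 *)

(** By covering, the map [p.1 * p.2^-1] sends these pairs onto [F]. *)
Lemma card_differences (gT : finGroupType) (G : {group gT}) (S F : {set gT}) :
  covering_set G S -> F \subset G ->
  #|F| <= #|[set p in setX S S | p.1 * p.2^-1 \in F]|.
Proof.
move=> [_ cov] /subsetP FG.
apply: leq_trans (leq_imset_card (fun p => p.1 * p.2^-1) _).
apply/subset_leq_card/subsetP=> g Fg; apply/imsetP.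
have [t [t' [St St' eg]]] := cov g (FG g Fg).
by exists (t, t') => //; rewrite !inE /= St St' -eg.
Qed.

Lemma card_offdiag (T : finType) (S : {set T}) :
  (#|[set p in setX S S | p.1 != p.2]| + #|S| = #|S| ^ 2)%N.
Proof.
rewrite -mulnn -cardsX -(cardsID [set p | p.1 == p.2] (setX S S)) addnC.
congr addn; last by apply: eq_card => p; rewrite !inE andbC.
have diag_inj : injective (fun x : T => (x, x)) by move=> x y [].
rewrite -(card_imset S diag_inj); apply: eq_card => -[x y]; rewrite !inE /=.
apply/imsetP/idP => [[z Sz [-> ->]] | ]; first by rewrite Sz eqxx.
by move=> /andP[/andP[Sx _] /eqP <-]; exists x.
Qed.

(** The [#|G| - 1] non-identity elements are differences of off-diagonal pairs, of which there are
    [#|S| ^ 2 - #|S|]. *)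
Lemma covering_card (gT : finGroupType) (G : {group gT}) (S : {set gT}) :
  covering_set G S -> (#|G| + #|S| <= #|S| ^ 2 + 1)%N.
Proof.
move=> cov; rewrite -card_offdiag (cardsD1 1 G) group1.
have := card_differences cov (subsetDl G [set 1]).
set m := #|G :\ 1|; set k := #|[set p in _ | _]| => le_mk.
suff : (k <= #|[set p in setX S S | p.1 != p.2]|)%N by lia.
apply/subset_leq_card/subsetP=> -[x y]; rewrite !inE -eq_mulgV1 /=.
by case/and3P=> -> ->.
Qed.

Lemma covering_card_neq42 (gT : finGroupType) (G : {group gT}) (S : {set gT}) :
  covering_set G S -> #|S| = 7 -> #|G| <> 42.
Proof.
move=> cov cardS cardG; have [/subsetP SG _] := cov.
have [e [eM card_e]] := @regular_sign gT G 21 cardG isT.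
have e1 : e 1 = false.
  by have := eM 1 1 (group1 G) (group1 G); rewrite mulg1 addbb => ->.
have eV : {in G &, forall x y, e (x * y^-1) = e x (+) e y}.
  move=> x y Gx Gy; rewrite eM ?groupV //; congr addb.
  have := eM y y^-1 Gy; rewrite groupV mulgV e1 => /(_ Gy).
  by case: (e y); case: (e y^-1).
pose A := [set x in S | e x]; pose B := [set x in S | ~~ e x].
have AB : (#|A| + #|B| = 7)%N.
  rewrite -cardS -(cardsID [set x | e x] S).
  by congr addn; apply: eq_card => x; rewrite !inE // andbC.
pose F1 := [set x in G | e x].
pose F0 := [set x in G^# | ~~ e x].
have F1G : F1 \subset G by apply/subsetP=> x; rewrite inE => /andP[].
have F0G : F0 \subset G by apply/subsetP=> x; rewrite !inE => /andP[/andP[]].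
(* The kernel of [e] has 21 elements, and [F0] omits the identity. *)
have card_F0 : #|F0| = 20.
  have := cardsID [set x | e x] G^#.
  have -> : G^# :&: [set x | e x] = F1.
    apply/setP=> x; rewrite !inE -andbA.
    by case: (eqVneq x 1) => // ->; rewrite e1 andbF.
  have -> : G^# :\: [set x | e x] = F0.
    by apply/setP=> x; rewrite !inE andbC.
  have := cardsD1 1 G; rewrite group1 cardG card_e /= => E1 E2.
  move: E1; rewrite -E2; move: #|F0| => k; lia.
have := card_differences cov F1G; have := card_differences cov F0G.
rewrite card_F0 card_e.
set D0 := [set p in _ | _]; set D1 := [set p in _ | _] => le0 le1.
(* Diagonal pairs give the identity, which is in neither [F0] nor [F1]; this leaves [7 * 7 - 7]
   pairs. *)
have D01 : (#|D0| + #|D1| <= 42)%N.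
  have dis : D0 :&: D1 = set0.
    apply/setP=> p; rewrite !inE.
    by case: (e _); rewrite ?andbF.
  have -> : 42 = #|[set p in setX S S | p.1 != p.2]|.
    by have := card_offdiag S; rewrite cardS; lia.
  rewrite -cardsUI dis cards0 addn0.
  apply/subset_leq_card/subsetP=> -[x y]; rewrite !inE -eq_mulgV1 /=.
  case: eqVneq => [->|_]; last by rewrite andbT -andb_orr => /andP[].
  by rewrite mulgV e1 !andbF.
(* A difference is odd exactly when one entry lies in [A] and the other in [B]. *)
have cardD1 : #|D1| = (2 * (#|A| * #|B|))%N.
  have dis : setX A B :&: setX B A = set0.
    apply/setP=> p; rewrite !inE.
    by case: (e p.1); rewrite ?andbF.
  have -> : D1 = setX A B :|: setX B A.
    apply/setP=> -[x y]; rewrite !inE /=.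
    case Sx: (x \in S) => //; case Sy: (y \in S); rewrite ?andbF //.
    rewrite groupM ?groupV ?SG // eV ?SG //.
    by case: (e x); case: (e y).
  by rewrite cardsU dis cards0 !cardsX; lia.
have {}AB : #|B| = (7 - #|A|)%N by lia.
have : (#|A| <= 7)%N.
  by rewrite -cardS subset_leq_card //; apply/subsetP=> x /[!inE] /andP[].
move: le0 le1 D01; rewrite cardD1 AB; move: #|A| #|D0| => a d0.
(* The bounds force [21 <= 2 * (a * (7 - a)) <= 22], but [a * (7 - a)] takes only the values 0, 6,
   10 and 12. *)
by do 8?[case: a => [|a] //]; lia.
Qed.

Lemma nonabelian_covering_order7_le m :
  nonabelian_covering_order 7 m -> m <= 40.
Proof.
move=> [gT [G [S [abG <- cardS cov]]]].
have := covering_card cov; have := covering_card_neq42 cov cardS.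
have not_prime : ~~ prime #|G|.
  by apply: contra abG => /prime_cyclic/cyclic_abelian.
rewrite cardS; move: #|G| not_prime => n; rewrite leqNgt => np n42 n43.
apply/negP=> n40; have : n = 41 \/ n = 43 by lia.
by case=> nE; move: np; rewrite nE.
Qed.

(** * The semidirect product model of order 40 *)

(* A pair (i, j) stands for a^i b^j; since b a = a^2 b, moving b^j past a^k
   turns it into a^(2^j k). *)
Definition Gamma1_model := ('I_5 * 'I_8)%type.

HB.instance Definition _ := Finite.on Gamma1_model.

Section Model.

Local Open Scope nat_scope.

Implicit Types u v w : Gamma1_model.

Definition model_elt (i j : nat) : Gamma1_model :=
  (Ordinal (ltn_pmod i (isT : 0 < 5)), Ordinal (ltn_pmod j (isT : 0 < 8))).

Definition model_mul u v := model_elt (u.1 + 2 ^ u.2 * v.1) (u.2 + v.2).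

(* The exponent 7 j represents - j mod 8, and the factor 4 is - 1 mod 5;
   reducing 7 j keeps the unary powers of 2 small enough to compute with. *)
Definition model_inv u :=
  model_elt (4 * 2 ^ (7 * u.2 %% 8) * u.1) (7 * u.2).

Lemma model_elt_eq i j i' j' :
  i = i' %[mod 5] -> j = j' %[mod 8] -> model_elt i j = model_elt i' j'.
Proof. by move=> ei ej; congr pair; apply: val_inj. Qed.

Lemma model_eltK u : model_elt u.1 u.2 = u.
Proof.
by case: u => i j; congr pair; apply: val_inj; rewrite /= modn_small.
Qed.

Lemma exp2_mod8 j : 2 ^ (j %% 8) = 2 ^ j %[mod 5].
Proof.
(* Since [2 ^ 8 = 256] is 1 modulo 5, the twist depends only on the exponent of [b] modulo 8. *)
have e : (2 ^ 8) ^ (j %/ 8) = 1 %[mod 5] by rewrite -modnXm exp1n.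
by rewrite [in RHS](divn_eq j 8) expnD [_ * 8]mulnC expnM -modnMml e mul1n.
Qed.

Lemma model_mulA : associative model_mul.
Proof.
move=> u v w; apply: model_elt_eq => /=.
  (* Both sides are [u.1 + 2 ^ u.2 * v.1 + 2 ^ (u.2 + v.2) * w.1] modulo 5. *)
  rewrite modnDml -modnDmr modnMmr modnDmr.
  rewrite -[in RHS]modnDmr -[in RHS]modnMml exp2_mod8 modnMml modnDmr.
  by rewrite mulnDr expnD addnA mulnA.
by rewrite modnDml modnDmr addnA.
Qed.

Lemma model_mul1 : left_id (model_elt 0 0) model_mul.
Proof. by move=> u; rewrite /model_mul /= mul1n model_eltK. Qed.

Lemma model_mulV : left_inverse (model_elt 0 0) model_inv model_mul.
Proof.
move=> u; apply: model_elt_eq => /=.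
  by rewrite modnDml -mulnA -mulSnr modnMr.
by rewrite modnDml -mulSnr modnMr.
Qed.

HB.instance Definition _ :=
  Finite_isGroup.Build Gamma1_model model_mulA model_mul1 model_mulV.

End Model.

(** * Normal forms and the universal property of the model *)

Definition model_a : Gamma1_model := model_elt 1 0.
Definition model_b : Gamma1_model := model_elt 0 1.

Lemma model_relations : Gamma1_relations model_a model_b.
Proof.
by split; apply/eqP; vm_compute.
Qed.

(** Moving one [y] past a power of [x] doubles the exponent of [x]; induction on [j] iterates
    this. *)
Lemma relations_conjX (H : groupType) (x y : H) j k :
  Gamma1_relations x y -> y ^+ j * x ^+ k = x ^+ (2 ^ j * k) * y ^+ j.
Proof.
case=> _ _ yx.
have yx1 i : y * x ^+ i = x ^+ (2 * i) * y.
  elim: i => [|i IH]; first by rewrite muln0 !expg0 mulg1 mul1g.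
  have xy : y * x = x ^+ 2 * y by rewrite -yx -mulgA mulVg mulg1.
  by rewrite expgS mulgA xy -mulgA IH mulgA mulnS -expgnDr.
elim: j k => [|j IH] k; first by rewrite expn0 mul1n expg0 mulg1 mul1g.
by rewrite expgSr -mulgA yx1 mulgA IH expnSr -mulnA mulgA.
Qed.

Lemma expg_modn (H : groupType) (x : H) n k :
  x ^+ n = 1 -> x ^+ (k %% n) = x ^+ k.
Proof.
move=> xn.
by rewrite {2}(divn_eq k n) expgnDr mulnC expgnA xn expg1n mul1g.
Qed.

Definition model_lift (H : groupType) (x y : H) (u : Gamma1_model) : H :=
  x ^+ u.1 * y ^+ u.2.

(** Reducing exponents modulo 5 and 8 is harmless because [x ^+ 5 = 1] and [y ^+ 8 = 1]; the twist
    in the product is [relations_conjX]. *)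
Lemma model_liftM (H : groupType) (x y : H) :
  Gamma1_relations x y -> {morph model_lift x y : u v / u * v}.
Proof.
move=> rel u v; have [x5 y8 _] := rel.
rewrite /model_lift /= !expg_modn // (expgnDr x) (expgnDr y) -!mulgA.
by congr (_ * _); rewrite [RHS]mulgA (relations_conjX _ _ rel) mulgA.
Qed.

Lemma model_lift_a (H : groupType) (x y : H) : model_lift x y model_a = x.
Proof. by rewrite /model_lift /= expg1 expg0 mulg1. Qed.

Lemma model_lift_b (H : groupType) (x y : H) : model_lift x y model_b = y.
Proof. by rewrite /model_lift /= expg1 expg0 mul1g. Qed.

(** This is the normal form [a^i b^j] inside the model. It gives generation by [model_a] and
    [model_b], and later the injectivity of the map onto [G]. *)
Lemma model_lift_id : model_lift model_a model_b =1 id.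
Proof.
have aX i : model_a ^+ i = model_elt i 0.
  by elim: i => // i IH; rewrite expgS IH; apply: model_elt_eq;
     rewrite /= ?mul1n ?modnDmr.
have bX j : model_b ^+ j = model_elt 0 j.
  by elim: j => // j IH; rewrite expgS IH; apply: model_elt_eq;
     rewrite /= ?modnDmr.
move=> u; rewrite /model_lift aX bX -[RHS]model_eltK; apply: model_elt_eq => /=.
  by rewrite muln0 addn0 modn_mod.
by rewrite modn_mod.
Qed.

Lemma model_gen : [set: Gamma1_model] = <<[set model_a; model_b]>>.
Proof.
apply/eqP; rewrite eqEsubset subsetT andbT; apply/subsetP=> u _.
by rewrite -(model_lift_id u) groupM // groupX // mem_gen // !inE eqxx ?orbT.
Qed.

Lemma model_is_Gamma1 : is_Gamma1 [set: Gamma1_model]%G model_a model_b.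
Proof.
split; [exact: model_gen | exact: model_relations | move=> H x y rel].
exists (model_lift x y).
split; [apply: in2W; apply: model_liftM | exact: model_lift_a |] => //.
exact: model_lift_b.
Qed.

(** * Transport along injective morphisms, and covering from the difference property *)

Lemma diff_mult_injm (aT rT : finGroupType) (D : {group aT})
    (f : {morphism D >-> rT}) (S : {set aT}) g :
  'injm f -> S \subset D -> g \in D ->
  diff_mult (f @* S) (f g) = diff_mult S g.
Proof.
move=> /injmP injf /subsetP SD Dg; rewrite /diff_mult.
pose ff p := (f p.1, f p.2).
rewrite -(card_in_imset (f := ff)) => [|[x y] [x' y']]; last first.
  rewrite !inE /= => /andP[/andP[Sx Sy] _] /andP[/andP[Sx' Sy'] _] [].
  move=> /(injf _ _ (SD _ Sx) (SD _ Sx'))->.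
  by move=> /(injf _ _ (SD _ Sy) (SD _ Sy'))->.
apply: eq_card => -[u v]; rewrite !inE /=; apply/idP/imsetP.
  case/andP=> /andP[/morphimP[x Dx Sx ->] /morphimP[y Dy Sy ->]] /eqP fE.
  exists (x, y); rewrite ?inE //= Sx Sy.
  by apply/eqP/injf; rewrite ?groupM ?groupV // morphM ?groupV // morphV.
case=> -[x y]; rewrite !inE /= => /andP[/andP[Sx Sy] /eqP <-] [-> ->].
have [Dx Dy] := (SD x Sx, SD y Sy).
by rewrite !mem_morphim //= morphM ?groupV // morphV.
Qed.

Lemma almost_difference_set_injm (aT rT : finGroupType) (D G : {group aT})
    (f : {morphism D >-> rT}) (S : {set aT}) n s l t :
  'injm f -> G \subset D -> almost_difference_set G S n s l t ->
  almost_difference_set (f @* G)%G (f @* S) n s l t.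
Proof.
move=> injf GD [SG cardG cardS cardl multS].
have SD := subset_trans SG GD.
have G1D : G^# \subset D by apply: subset_trans GD; apply: subsetDl.
have fG1 : (f @* G)^# = f @* G^# by rewrite injmD1.
split; rewrite ?morphimS ?card_injm //; last first.
  move=> g; rewrite fG1 => /morphimP[x Dx Gx ->].
  by rewrite diff_mult_injm // => /multS->.
rewrite -cardl fG1.
set T := [set g in G^# | _].
have TD : T \subset D.
  by apply: subset_trans G1D; apply/subsetP=> x; rewrite inE => /andP[].
rewrite -(card_injm injf TD); apply: eq_card => y; rewrite inE.
apply/andP/morphimP => [[/morphimP[x Dx Gx ->]]|[x Dx]].
  by rewrite diff_mult_injm // => eqx; exists x; rewrite // inE Gx.
by rewrite inE => /andP[Gx eqx] ->; rewrite mem_morphim // diff_mult_injm.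
Qed.

(** Non-identity elements have multiplicity [l] or [l.+1], both positive; the identity is [x * x^-1]
    for any [x] in the nonempty [S]. *)
Lemma almost_difference_set_covering (gT : finGroupType) (G : {group gT})
    (S : {set gT}) n s l t :
  0 < s -> 0 < l -> almost_difference_set G S n s l t -> covering_set G S.
Proof.
move=> s_gt0 l_gt0 [SG _ cardS _ multS]; split=> // g Gg.
have [-> | g1] := eqVneq g 1.
  have [|x Sx] := set0Pn S _; first by rewrite -card_gt0 cardS.
  by exists x, x; rewrite mulgV.
have /card_gt0P[[x y]] : 0 < diff_mult S g.
  have [-> // | ne] := eqVneq (diff_mult S g) l.
  by rewrite multS // !inE g1.
by rewrite !inE /= => /andP[/andP[Sx Sy] /eqP <-]; exists x, y.
Qed.

(** * The finite check in the model *)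

(** Replaces a cardinality by a count over an explicit list, which [vm_compute] can evaluate. *)
Lemma diff_mult_seq (gT : finGroupType) (s : seq gT) g :
  uniq s ->
  diff_mult [set x in s] g = count_mem g [seq x * y^-1 | x <- s, y <- s].
Proof.
move=> s_uniq; pose ps := [seq (x, y) | x <- s, y <- s].
have -> : [seq x * y^-1 | x <- s, y <- s] = [seq p.1 * p.2^-1 | p <- ps].
  by rewrite map_allpairs.
rewrite count_map -size_filter -(card_uniqP _); last first.
  by rewrite filter_uniq // allpairs_uniq // => -[? ?] [].
apply: eq_card => -[x y]; rewrite !inE mem_filter andbC /=; congr (_ && _).
apply/andP/allpairsP => [[sx sy] | [[x' y'] [/= sx sy [-> ->]]]] //.
by exists (x, y).
Qed.

Definition model_enum : seq Gamma1_model :=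
  [seq model_elt i j | i <- iota 0 5, j <- iota 0 8].

Lemma mem_model_enum u : u \in model_enum.
Proof.
rewrite -(model_eltK u).
by apply: allpairs_f; rewrite mem_iota /= add0n ltn_ord.
Qed.

Lemma card_model : #|{: Gamma1_model}| = 40.
Proof. by rewrite card_prod !card_ord. Qed.

Lemma model_ads :
  almost_difference_set [set: Gamma1_model]%G (Gamma1_S model_a model_b)
    40 7 1 36.
Proof.
pose s := [:: 1; model_b; model_b ^+ 4; model_b * model_a;
  model_b * model_a^-1 * model_b ^+ 2; model_a * model_b^-1;
  model_b * model_a * model_b ^+ 2].
have s_uniq : uniq s by vm_compute.
have -> : Gamma1_S model_a model_b = [set x in s].
  by apply/setP=> x; rewrite !inE -!orbA.
pose d := [seq x * y^-1 | x <- s, y <- s].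
pose mult g := count_mem g d.
split; rewrite ?subsetT ?cardsT ?card_model //.
- by rewrite cardsE (card_uniqP s_uniq).
- pose r := [seq g <- model_enum | (g != 1) && (mult g == 1)%N].
  have <- : size r = 36 by vm_compute.
  rewrite -(card_uniqP (_ : uniq r)); last by vm_compute.
  apply: eq_card => g; rewrite [RHS]mem_filter mem_model_enum andbT.
  by rewrite in_set in_setD1 in_setT andbT diff_mult_seq.
- move=> g; rewrite in_setD1 in_setT andbT diff_mult_seq // -/d -/(mult g).
  move=> g1.
  have := mem_model_enum g.
  have /allP H :
      all (fun x => [|| x == 1, mult x == 1%N | mult x == 2]) model_enum.
    by vm_compute.
  by move/H; rewrite (negPf g1) /= => /orP[->|/eqP].
Qed.

(** * Transfer to every realisation of the presentation *)

(** The lift [h] from the model is onto [G] because [a] and [b] generate it. The universal property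
    of [G], applied to the model, yields a left inverse [f], so [h] is an isomorphism carrying one
    set to the other. *)
Lemma is_Gamma1_ads (gT : finGroupType) (G : {group gT}) (a b : gT) :
  is_Gamma1 G a b ->
  #|G| = 40 /\ almost_difference_set G (Gamma1_S a b) 40 7 1 36.
Proof.
case=> genG rel univ.
have [f [fM fa fb]] := univ _ _ _ model_relations.
have hM : {in [set: Gamma1_model] &, {morph model_lift a b : u v / u * v}}.
  by apply: in2W; apply: model_liftM.
pose h := Morphism hM.
have [ha hb] : h model_a = a /\ h model_b = b.
  by split; [exact: model_lift_a | exact: model_lift_b].
have hG : h @* [set: Gamma1_model] = G.
  transitivity (h @* <<[set model_a; model_b]>>).
    by congr (h @* _); apply: model_gen.
  rewrite morphim_gen ?subsetT // morphimU !morphim_set1 ?inE //.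
  by rewrite ha hb genG.
have [Ga Gb] : a \in G /\ b \in G.
  by rewrite genG !mem_gen // !inE eqxx ?orbT.
(* [f] is a bare function multiplicative on [G], so its values at 1 and at powers are derived by
   hand. *)
have f1 : f 1 = 1.
  by apply: (mulgI (f 1)); rewrite -fM ?group1 // !mulg1.
have fX x n : x \in G -> f (x ^+ n) = f x ^+ n.
  by move=> Gx; elim: n => // n IH; rewrite !expgS fM ?groupX // IH.
have fh u : f (h u) = u.
  rewrite /= /model_lift fM ?groupX // !fX // fa fb -/(model_lift _ _ u).
  exact: model_lift_id.
have injh : 'injm h by apply/injmP=> u v _ _ /(congr1 f); rewrite !fh.
have hS : h @* Gamma1_S model_a model_b = Gamma1_S a b.
  rewrite /Gamma1_S !morphimU !morphim_set1 ?inE //.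
  by rewrite !(morphM, morphX, morphV, morph1) ?inE // ha hb.
have := almost_difference_set_injm injh (subxx _) model_ads.
have -> : (h @* [set: Gamma1_model])%G = G by apply: val_inj.
by rewrite hS => ads; split=> //; case: ads.
Qed.

Lemma nonabelian_covering_order7_40 : nonabelian_covering_order 7 40.
Proof.
exists _, [set: Gamma1_model]%G, (Gamma1_S model_a model_b).
have ads := model_ads; have [_ cardG cardS _ _] := ads.
split=> //; last exact: almost_difference_set_covering ads.
apply/negP=> /centsP/(_ model_a (in_setT _) model_b (in_setT _))/eqP.
by vm_compute.
Qed.

Theorem proposition3p4 :
  is_maximum (nonabelian_covering_order 7) 40 /\
  (exists (gT : finGroupType) (G : {group gT}) (a b : gT),
      is_Gamma1 G a b) /\
  (forall (gT : finGroupType) (G : {group gT}) (a b : gT),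
      is_Gamma1 G a b ->
      #|G| = 40 /\
      almost_difference_set G (Gamma1_S a b) 40 7 1 36).
Proof.
split; [|split].
- split; first exact: nonabelian_covering_order7_40.
  exact: nonabelian_covering_order7_le.
- by exists _, [set: Gamma1_model]%G, model_a, model_b; apply: model_is_Gamma1.
- exact: is_Gamma1_ads.
Qed.
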